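(* Let $n\geqslant 1$ be fixed and let $G_n(H)$ be the number of distinct fields $\mathbb{Q}(\sqrt{a_1},\ldots,\sqrt{a_n})$ with $(a_1,\ldots,a_n)\in\mathbb{N}^n\cap[1,H]^n$ such that $\#\mathrm{Gal}(\mathbb{Q}(\sqrt{a_1},\ldots,\sqrt{a_n})/\mathbb{Q})=2^n$. Then, as $H\to\infty$, $$G_n(H)=\Big(\frac{1}{n!\,\zeta(2)^n}+O\Big(e^{-(1+o(1))\sqrt{(\log H)(\log\log H)/2}}\Big)\Big)H^n,$$ where $\zeta$ is the Riemann zeta function. *)

(* Defs.v *)
From HB Require Import structures.
From mathcomp Require Import all_boot all_order all_algebra all_fingroup all_field.
From mathcomp Require Import finmap.
From mathcomp Require Import all_classical all_reals all_analysis.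

Set Implicit Arguments.
Unset Strict Implicit.
Unset Printing Implicit Defensive.

Import Order.TTheory GRing.Theory Num.Theory.
Import numFieldNormedType.Exports.

Local Open Scope classical_set_scope.
Local Open Scope ring_scope.

(* Since x / 0 = 0 in algC, divring_closed says exactly that K is a subfield. *)
Definition subfield (K : set algC) : Prop := divring_closed [in K].

Definition multiquadratic (n : nat) (a : 'I_n -> nat) : set algC :=
  smallest subfield (range (fun i => sqrtC ((a i)%:R : algC))).

(* The library attaches Galois groups to abstract extensions of rat, so
   Gal(K/Q) is taken in such an extension L embedded in algC with image K;
   two choices of L are isomorphic, so m depends on K only. *)
Definition gal_order (K : set algC) (m : nat) : Prop :=
  exists (L : splittingFieldType rat) (iota : {rmorphism L -> algC}),
    range iota = K /\ #|'Gal({:L} / 1)%g| = m.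

Definition multiquadratic_fields (R : realType) (n : nat) (H : R) :
    set (set algC) :=
  [set K | exists a : 'I_n -> nat,
     [/\ forall i, (1 <= a i)%N /\ (a i)%:R <= H,
         K = multiquadratic a
       & gal_order K (2 ^ n)]].

(* fset_set sends infinite sets to the empty set, hence this check. *)
Lemma finite_multiquadratic_fields (R : realType) (n : nat) (H : R) :
  finite_set (multiquadratic_fields n H).
Proof.
pose N := (Num.truncn H).+1.
pose f (a : {ffun 'I_n -> 'I_N}) := multiquadratic (fun i => a i : nat).
apply: (@sub_finite_set _ _ (range f)); last exact: finite_image.
move=> K [a [aH -> _]].
have aN i : (a i < N)%N.
  have [_ aH'] := aH i.
  by rewrite ltnS truncn_ge_nat// (le_trans _ aH').
exists [ffun i => Ordinal (aN i)] => //.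
by rewrite /f; congr multiquadratic; apply/funext => i; rewrite ffunE.
Qed.

Definition G (R : realType) (n : nat) (H : R) : nat :=
  #|` fset_set (multiquadratic_fields n H)|%fset.

(* Meaningful for s > 1, where the series converges. *)
Definition zeta (R : realType) (s : R) : R :=
  limn (series (fun k : nat => k.+1%:R `^ (- s))).

(* Main.v *)
Require Import Defs.
From HB Require Import structures.
From mathcomp Require Import all_boot all_order all_algebra all_fingroup all_field.
From mathcomp Require Import finmap.
From mathcomp Require Import all_classical all_reals all_analysis.
From mathcomp Require Import zify ring lra.
Set Implicit Arguments.
Unset Strict Implicit.
Unset Printing Implicit Defensive.
Import Order.TTheory GRing.Theory Num.Theory.
Import numFieldNormedType.Exports.

(** A field of degree [2 ^ n] generated by square roots of integers up to [H] is
    generated by the square roots of an [n]-element set of squarefree integers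
    up to [H]. This gives the upper bound ['C(S, n)], [S] being the number of
    squarefree integers up to [H].

    Conversely, [sqrt m] lies in [Q(sqrt b_1, .., sqrt b_n)] only if [m] times
    the product of some subset [B] of the [b_i] is a square. If all [b_i]
    exceed [L] and have pairwise gcds at most [Q], with [L ^ 2] larger than
    [H * Q ^ (2 n - 1)], and [m <= H] is squarefree, this forces [B = {m}]:
    every [b] in [B] divides [m] times its gcds with the rest of [B], so two
    elements of [B] would satisfy [b * b' <= m * Q ^ (2 n - 1)]. Such sets are
    therefore determined by their field, which has degree [2 ^ n], and all but
    [O(H ^ n / Q)] sets are of this kind, [Q] being a small power of [H].

    Finally [S = H / zeta 2 + O(H ^ (47 / 48))]. Counting integers by their
    largest square divisor gives [floor x = \sum_d S (x / d ^ 2)], so the error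
    [e x = S x - x / zeta 2] satisfies [e x = O(1) - \sum_(d >= 2) e (x / d ^ 2)],
    and the bound follows by induction on [x], without Moebius inversion.

    The resulting relative error is a negative power of [H], smaller than
    the one claimed; in particular the [o(1)] may be taken to be [0]. *)

(** * Squarefree integers *)

(** [primes 0] is empty, so positivity has to be required separately. *)
Definition squarefree (m : nat) : bool :=
  (0 < m) && all (fun p => logn p m == 1) (primes m).

Definition squarefree_count (N : nat) : nat := \sum_(s < N.+1) squarefree s.

Lemma squarefree_gt0 m : squarefree m -> 0 < m.
Proof. by case/andP. Qed.

Lemma logn_squarefree p m : squarefree m -> logn p m = (p \in primes m).
Proof.
case/andP => _ /allP sm; case: (boolP (p \in primes m)) => [/sm/eqP //|].
by rewrite -logn_gt0 -eqn0Ngt => /eqP.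
Qed.

(** Strong induction: if some prime [p] has exponent at least 2, a factor [p ^ 2] moves into the
    square. *)
Lemma squarefree_decomposition m : 0 < m ->
  exists s d, [/\ squarefree s, 0 < d & m = s * d ^ 2].
Proof.
elim/ltn_ind: m => m IH m0; case: (boolP (squarefree m)) => [sm|].
  by exists m, 1; rewrite muln1.
rewrite /squarefree m0 /= -has_predC => /hasP[p pm /=].
have := pm; rewrite -logn_gt0 => lp0 lp1.
have pp : prime p by move: pm; rewrite mem_primes => /andP[].
have : p ^ 2 %| m by rewrite pfactor_dvdn //; lia.
case/dvdnP => k mk; have k0 : 0 < k by move: m0; rewrite mk muln_gt0 => /andP[].
have p1 := prime_gt1 pp.
have /IH /(_ k0) [s [d [ss d0 kE]]] : k < m.
  by rewrite mk -mulnn; nia.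
exists s, (d * p); split => //; first by rewrite muln_gt0 d0 ltnW.
by rewrite mk kE expnMn mulnA.
Qed.

(** Each prime has exponent 0 or 1 in [s], so by parity its exponent in [s * d ^ 2] determines its
    exponents in [s] and in [d]. *)
Lemma eq_squarefree_decomposition s d s' d' :
  squarefree s -> squarefree s' -> 0 < d -> 0 < d' ->
  s * d ^ 2 = s' * d' ^ 2 -> s = s' /\ d = d'.
Proof.
move=> sf sf' d0 d0' E.
have [s0 s0'] := (squarefree_gt0 sf, squarefree_gt0 sf').
suff H p : logn p d = logn p d'.
  have dE : d = d' by apply: eqn_from_log.
  split=> //; apply/eqP; rewrite -(@eqn_pmul2r (d ^ 2)) ?expn_gt0 ?d0 //.
  by rewrite E dE.
have := congr1 (logn p) E.
rewrite -!mulnn !lognM ?muln_gt0 ?d0 ?d0' // (logn_squarefree _ sf) (logn_squarefree _ sf').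
by case: (_ \in _); case: (_ \in _); lia.
Qed.

Lemma squarefree_mul_square b b' r :
  squarefree b -> squarefree b' -> b * b' = r ^ 2 -> b = b'.
Proof.
move=> sb sb' E; have [b0 b0'] := (squarefree_gt0 sb, squarefree_gt0 sb').
have r0 : 0 < r.
  by have : 0 < r ^ 2; [rewrite -E muln_gt0 b0|rewrite expn_gt0 orbF].
(* These are two decompositions of one integer: [b * b' ^ 2 = b' * r ^ 2]. *)
have [] // := @eq_squarefree_decomposition b b' b' r sb sb' b0' r0.
by rewrite -E; lia.
Qed.

Lemma squarefree_square b r : squarefree b -> b = r ^ 2 -> b = 1.
Proof.
move=> sb E; apply: (@squarefree_mul_square b 1 r) => //.
by rewrite muln1.
Qed.

Lemma squarefree_countS N :
  squarefree_count N.+1 = squarefree_count N + squarefree N.+1.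
Proof. by rewrite /squarefree_count big_ord_recr. Qed.

(** Each positive integer up to [N] is counted once, at the [d] whose square is its largest square
    divisor. In the induction, passing to [N.+1] changes only the summand at that [d]. *)
Lemma sum_squarefree_count N D : N <= D ->
  \sum_(1 <= d < D.+1) squarefree_count (N %/ d ^ 2) = N.
Proof.
elim: N => [_|N IH ND].
  rewrite big1 // => d _; rewrite div0n /squarefree_count.
  by rewrite big_ord1.
rewrite -[RHS]addn1 -{2}(IH (ltnW ND)).
pose f d := (d ^ 2 %| N.+1) && squarefree (N.+1 %/ d ^ 2).
rewrite (eq_big_nat _ _ (F2 := fun d =>
    squarefree_count (N %/ d ^ 2) + f d)); last first.
  move=> d /andP[d1 _]; rewrite /f divnS ?expn_gt0 ?d1 //.
  case: (_ %| _) => /=; last by rewrite addn0.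
  by rewrite squarefree_countS.
rewrite big_split /=; congr addn.
have [s [d [ss d0 NE]]] := @squarefree_decomposition N.+1 isT.
have dD : d \in index_iota 1 D.+1.
  rewrite mem_index_iota d0 ltnS (leq_trans _ ND) // NE.
  have := squarefree_gt0 ss; nia.
rewrite (bigD1_seq d) ?iota_uniq //= big1_seq => [|d' /andP[d'd]].
  rewrite /f NE dvdn_mull // mulnK ?ss //.
  by rewrite expn_gt0 d0.
rewrite mem_index_iota => /andP[d'0 _]; apply/eqP; rewrite eqb0.
apply: contra d'd; case/andP => /dvdnP[k kE].
rewrite kE mulnK ?expn_gt0 ?d'0 // => sk.
by rewrite NE in kE; have [_ ->] := eq_squarefree_decomposition ss sk d0 d'0 kE.
Qed.

(** * Square products of squarefree integers *)

Lemma squarefree_dvdn b X : squarefree b ->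
  (forall p, prime p -> p %| b -> p %| X) -> b %| X.
Proof.
move=> sb H; have b0 := squarefree_gt0 sb.
have [->|X0] := posnP X; first exact: dvdn0.
apply/dvdn_partP => // p; rewrite -[p \in \pi(b)]/(p \in primes b) => pb.
rewrite p_part logn_squarefree // pb expn1.
by move: pb; rewrite mem_primes => /and3P[pp _ /H]; apply.
Qed.

Lemma prod_gt0_seq (s : seq nat) : (forall b, b \in s -> 0 < b) ->
  0 < \prod_(b <- s) b.
Proof. by move=> H; rewrite big_seq; apply: prodn_cond_gt0. Qed.

Lemma logn_prod_eq0 p (s : seq nat) : (forall b, b \in s -> 0 < b) ->
  (forall b, b \in s -> ~~ (p %| b)) -> logn p (\prod_(b <- s) b) = 0.
Proof.
elim: s => [|b s IH] s0 sp; first by rewrite big_nil logn1.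
have H x : x \in s -> x \in b :: s by rewrite inE orbC => ->.
have P0 : 0 < \prod_(x <- s) x by apply: prod_gt0_seq => x /H/s0.
have b0 : 0 < b by rewrite s0 ?mem_head.
rewrite big_cons lognM //.
rewrite IH => [|x /H/s0|x /H/sp] //.
rewrite addn0; apply/eqP; rewrite -leqn0 leqNgt logn_gt0 mem_primes.
by rewrite (negPf (sp b (mem_head _ _))) !andbF.
Qed.

Lemma leq_prod_const (I : Type) (r : seq I) (F : I -> nat) Q :
  all (fun i => F i <= Q) r -> \prod_(i <- r) F i <= Q ^ size r.
Proof.
elim: r => [|i r IH] /=; first by rewrite big_nil.
by case/andP => Fi /IH; rewrite big_cons expnS; apply: leq_mul.
Qed.

(* A prime dividing exactly one element [b] of [B] must also divide [m], so
   [b] divides [m] times its gcds with the other elements of [B]. *)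
Lemma dvdn_mul_gcds m b (B : seq nat) r :
  0 < m -> b \in B -> (forall x, x \in B -> squarefree x) ->
  m * \prod_(x <- B) x = r ^ 2 ->
  b %| m * \prod_(x <- rem b B) gcdn b x.
Proof.
move=> m0 bB sB E; apply: squarefree_dvdn; first exact: sB.
move=> p pp pb; have [pm|pm] := boolP (p %| m); first exact: dvdn_mulr.
have [/hasP[x xB px]|/hasPn pB] := boolP (has (fun x => p %| x) (rem b B)).
  apply: dvdn_mull; rewrite (big_rem x xB) /= dvdn_mulr // dvdn_gcd pb.
  exact: px.
have rB x : x \in rem b B -> x \in B by apply: mem_rem.
have := congr1 (logn p) E.
rewrite lognX (big_rem b bB) /=.
have gtB x : x \in B -> 0 < x by move/sB/squarefree_gt0.
have b0 := gtB _ bB.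
have P0 : 0 < \prod_(x <- rem b B) x by apply: prod_gt0_seq => x /rB/gtB.
rewrite lognM ?muln_gt0 ?b0 // lognM //.
rewrite logn_prod_eq0 //; last by move=> x /rB/gtB.
rewrite (logn_squarefree _ (sB _ bB)).
have -> : p \in primes b by rewrite mem_primes pp gtB.
have -> : logn p m = 0.
  by apply/eqP; rewrite -leqn0 leqNgt logn_gt0 mem_primes (negPf pm) !andbF.
by lia.
Qed.

Definition sparse (L Q : nat) (s : seq nat) : Prop :=
  [/\ uniq s, forall x, x \in s -> squarefree x, forall x, x \in s -> L < x
    & forall x y, x \in s -> y \in s -> x != y -> gcdn x y <= Q].

(** The size of [B] decides: an empty [B] would force [m = 1], a single element must be [m], and two
    elements would be too large. *)
Lemma sparse_square_product n N L Q s B m r :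
  0 < L -> sparse L Q s -> size s <= n -> N * Q ^ (2 * n).-1 < L ^ 2 ->
  subseq B s -> squarefree m -> 1 < m <= N ->
  m * \prod_(b <- B) b = r ^ 2 -> B = [:: m].
Proof.
move=> L0 [us ss sL sQ] sn NQ Bs sm /andP[m1 mN].
have uB := subseq_uniq Bs us; have Bin := mem_subseq Bs.
have Bn : size B <= n by apply: leq_trans (size_subseq Bs) sn.
case: B Bs uB Bin Bn => [|b1 [|b2 B]] Bs uB Bin Bn E.
- move: E; rewrite big_nil muln1 => /(squarefree_square sm) m1'.
  by rewrite m1' in m1.
- move: E; rewrite big_seq1 => /squarefree_mul_square -> //.
  by apply/ss/Bin; rewrite inE.
exfalso; set BB := [:: b1, b2 & B] in E uB Bin Bn.
have [B1 B2] : b1 \in BB /\ b2 \in BB by rewrite !inE !eqxx orbT.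
have b12 : b1 != b2 by move: uB; rewrite /= inE negb_or -andbA => /andP[].
have bound b : b \in BB ->
    exists D, [/\ 0 < D, D <= Q ^ n.-1 & b %| m * D].
  move=> bB; exists (\prod_(x <- rem b BB) gcdn b x); split.
  - rewrite big_seq; apply: prodn_cond_gt0 => x _.
    by rewrite gcdn_gt0 (leq_ltn_trans _ (sL _ (Bin _ bB))).
  - have szr : size (rem b BB) = (size BB).-1 by rewrite size_rem.
    have gQ : all (fun x => gcdn b x <= Q) (rem b BB).
      apply/allP => x; rewrite mem_rem_uniq // inE => /andP[xb xB].
      by rewrite sQ ?Bin // eq_sym.
    have Q0 : 0 < Q.
      apply: leq_trans (sQ _ _ (Bin _ B1) (Bin _ B2) b12).
      by rewrite gcdn_gt0 (leq_ltn_trans _ (sL _ (Bin _ B1))).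
    apply: leq_trans (leq_prod_const gQ) _.
    by rewrite leq_pexp2l // szr; lia.
  - by apply: dvdn_mul_gcds E; [exact: ltnW | | move=> x /Bin/ss].
have [D1 [D10 D1Q bD1]] := bound _ B1.
have [D2 [D20 D2Q bD2]] := bound _ B2.
(* Since [b1 * b2] is the lcm times the gcd, it is at most [m * Q ^ n.-1 * Q ^ n.-1 * Q], which is
   less than [L ^ 2]. *)
have dl : lcmn b1 b2 %| m * D1 * D2.
  rewrite dvdn_lcm; apply/andP; split; first exact: dvdn_mulr.
  by rewrite mulnAC; apply: dvdn_mulr.
have lle : lcmn b1 b2 <= m * D1 * D2.
  by apply: dvdn_leq => //; rewrite !muln_gt0 D10 D20 ltnW.
have gle : gcdn b1 b2 <= Q by apply: sQ; rewrite ?Bin.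
have b1L := sL _ (Bin _ B1); have b2L := sL _ (Bin _ B2).
have n2 : 1 < n by apply: leq_trans Bn.
have : L ^ 2 < L ^ 2; last by rewrite ltnn.
apply: leq_ltn_trans NQ; apply: (@leq_trans (b1 * b2)).
  by rewrite -mulnn leq_mul // ltnW.
rewrite -muln_lcm_gcd; apply: leq_trans (leq_mul lle gle) _.
have -> : (2 * n).-1 = n.-1 + n.-1 + 1 by lia.
by rewrite !expnD expn1 !mulnA !leq_mul.
Qed.

(** * Counting sparse sets *)

Lemma card_ord_pos_sum N (P : pred nat) :
  #|[pred x : 'I_N.+1 | (0 < x) && P x]| = \sum_(x < N) P x.+1.
Proof.
rewrite -sum1_card big_mkcond big_ord_recl /= add0n; apply: eq_bigr => x _.
by rewrite inE /= /bump leq0n add1n; case: (P _).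
Qed.

Lemma card_multiples N g : 0 < g ->
  #|[pred x : 'I_N.+1 | (0 < x) && (g %| x)]| = N %/ g.
Proof.
move=> g0; rewrite (card_ord_pos_sum N (fun x => g %| x)).
elim: N => [|N IH]; first by rewrite big_ord0 div0n.
by rewrite big_ord_recr /= IH divnS // addnC.
Qed.

Lemma card_small N L : #|[pred x : 'I_N.+1 | (0 < x) && (x <= L)]| <= L.
Proof.
rewrite (card_ord_pos_sum N (fun x => x <= L)).
suff : \sum_(x < N) (x.+1 <= L) <= minn N L by lia.
elim: N => [|N IH]; first by rewrite big_ord0.
rewrite big_ord_recr /=; move: IH; move: (\sum_(_ < N) _) => S.
by rewrite !leq_min => /andP[SN SL]; case: (ltnP N L) => /=; lia.
Qed.

Lemma card_positive N : #|[pred x : 'I_N.+1 | 0 < x]| = N.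
Proof.
rewrite -[RHS]divn1 -card_multiples //.
by apply: eq_card => x; rewrite !inE dvd1n andbT.
Qed.

Lemma card_bigcup_le (I T : finType) (P : pred I) (F : I -> {set T}) :
  #|\bigcup_(i | P i) F i| <= \sum_(i | P i) #|F i|.
Proof.
elim/big_ind2: _ => [|A a B b Aa Bb|//]; first by rewrite cards0.
by rewrite (leq_trans (leq_card_setU _ _)) // leq_add.
Qed.

Lemma card_family_prod (I T : finType) (F : I -> pred T) :
  #|[set f : {ffun I -> T} | f \in family F]| = \prod_i #|F i|.
Proof. by rewrite cardsE card_family foldrE big_map enumT. Qed.

Section SparseSets.
Variables n N L Q : nat.
Local Notation T := 'I_N.+1.

Definition squarefree_set : {set T} := [set x : T | squarefree x].

Lemma card_squarefree_set : #|squarefree_set| = squarefree_count N.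
Proof.
rewrite /squarefree_count -sum1_card big_mkcond; apply: eq_bigr => x _.
by rewrite inE; case: squarefree.
Qed.

Definition squarefree_subsets : {set {set T}} :=
  [set A : {set T} | A \subset squarefree_set & #|A| == n].

Definition sparse_subsets : {set {set T}} :=
  [set A in squarefree_subsets | [forall (x | x \in A), L < x] &&
    [forall (x | x \in A), forall (y | y \in A), (x != y) ==> (gcdn x y <= Q)]].

(** Tuples replace sets because conditions imposed coordinate by coordinate define a product, whose
    cardinality is a product. Counting a set once per ordering costs only a constant factor. *)
Definition small_tuples (i : 'I_n) : {set {ffun 'I_n -> T}} :=
  [set f in family (fun k (x : T) => (0 < x) && ((k == i) ==> (x <= L)))].

Definition common_divisor_tuples (i j : 'I_n) (g : T) : {set {ffun 'I_n -> T}} :=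
  [set f in family (fun k (x : T) => (0 < x) && ((k \in [:: i; j]) ==> (g %| x)))].

Lemma card_small_tuples i : #|small_tuples i| <= L * N ^ n.-1.
Proof.
rewrite card_family_prod (bigD1 i) //=; apply: leq_mul.
  apply: leq_trans (card_small N L); apply/subset_leq_card/fintype.subsetP => x.
  by rewrite !inE /in_mem /= eqxx.
rewrite (leq_trans (n := \prod_(k | k != i) N)) //.
  apply: leq_prod => k ki; rewrite -[leqRHS]card_positive.
  by apply/subset_leq_card/fintype.subsetP => x; rewrite !inE /in_mem /= => /andP[].
by rewrite prod_nat_const cardC1 card_ord.
Qed.

Lemma card_common_divisor_tuples i j (g : T) : i != j -> 0 < g ->
  #|common_divisor_tuples i j g| <= (N %/ g) ^ 2 * N ^ n.-2.
Proof.
move=> ij g0; rewrite card_family_prod (bigD1 i) //= (bigD1 j) 1?eq_sym //= mulnA.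
have H k : k \in [:: i; j] ->
    #|[pred x : T | (0 < x) && ((k \in [:: i; j]) ==> (g %| x))]| <= N %/ g.
  by move=> ->; rewrite -card_multiples.
apply: leq_mul; first by rewrite -mulnn leq_mul // H ?inE ?eqxx ?orbT.
rewrite (leq_trans (n := \prod_(k | (k != i) && (k != j)) N)) //.
  apply: leq_prod => k ki; rewrite -[leqRHS]card_positive.
  by apply/subset_leq_card/fintype.subsetP => x; rewrite !inE /in_mem /= => /andP[].
rewrite prod_nat_const.
have -> : #|[pred k : 'I_n | (k != i) && (k != j)]| = n.-2; last by [].
have := cardsC [set i; j]; rewrite cards2 ij card_ord.
have -> : #|~: [set i; j]| = #|[pred k : 'I_n | (k != i) && (k != j)]|.
  by apply: eq_card => k; rewrite !inE negb_or.
by lia.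
Qed.

(** A union bound: over the position of an entry at most [L], and over the ordered pairs of
    positions together with the gcd [g > Q] of their entries. *)
Lemma card_not_sparse :
  #|squarefree_subsets :\: sparse_subsets| <=
  n * (L * N ^ n.-1) + n * n.-1 * \sum_(Q.+1 <= g < N.+1) (N %/ g) ^ 2 * N ^ n.-2.
Proof.
pose B1 := \bigcup_(i : 'I_n) small_tuples i.
pose B2 := \bigcup_(ij : 'I_n * 'I_n | ij.1 != ij.2)
  \bigcup_(g : T | Q < g) common_divisor_tuples ij.1 ij.2 g.
have cardB1 : #|B1| <= n * (L * N ^ n.-1).
  apply: (leq_trans (card_bigcup_le _ _)).
  apply: (@leq_trans (\sum_(i < n) L * N ^ n.-1)).
    by apply: leq_sum => i _; apply: card_small_tuples.
  by rewrite sum_nat_const card_ord.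
have cardB2 : #|B2| <=
    n * n.-1 * \sum_(Q.+1 <= g < N.+1) (N %/ g) ^ 2 * N ^ n.-2.
  set S := \sum_(_ <= _ < _) _.
  apply: (leq_trans (card_bigcup_le _ _)).
  apply: (@leq_trans (\sum_(ij : 'I_n * 'I_n | ij.1 != ij.2) S)).
    apply: leq_sum => -[i j] /= ij; apply: (leq_trans (card_bigcup_le _ _)).
    apply: (@leq_trans (\sum_(g : T | Q < g) (N %/ g) ^ 2 * N ^ n.-2)).
      apply: leq_sum => g Qg; apply: card_common_divisor_tuples => //.
      exact: leq_ltn_trans Qg.
    by rewrite /S big_geq_mkord.
  rewrite -(pair_big_dep xpredT (fun i j => i != j) (fun _ _ => S)) /=.
  rewrite -mulnA -[X in X * _](card_ord n) -sum_nat_const.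
  apply: leq_sum => i _; rewrite sum_nat_const leq_mul2r; apply/orP; right.
  rewrite -[X in _ <= X.-1]card_ord -(cardC1 i).
  by apply/subset_leq_card/fintype.subsetP => j; rewrite !inE eq_sym.
rewrite (leq_trans _ (leq_add cardB1 cardB2)) //.
rewrite (leq_trans _ (leq_card_setU B1 B2)) //.
(* Every set that is not sparse is the image of a tuple in [B1] or [B2], namely of an enumeration of
   its elements. *)
rewrite (leq_trans _ (leq_imset_card (fun f : {ffun 'I_n -> T} => f @: setT) _)) //.
apply/subset_leq_card/fintype.subsetP => A; rewrite finset.in_setD => /andP[nA AX].
have : ~~ ([forall (x | x \in A), L < x] &&
    [forall (x | x \in A), forall (y | y \in A), (x != y) ==> (gcdn x y <= Q)]).
  by move: nA; rewrite inE AX.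
move: AX; rewrite inE => /andP[/fintype.subsetP AS /eqP An] {}nA.
have Apos x : x \in A -> 0 < x by move/AS; rewrite inE => /squarefree_gt0.
pose f : {ffun 'I_n -> T} := [ffun i => enum_val (cast_ord (esym An) i)].
have fA i : f i \in A by rewrite ffunE enum_valP.
have Af x : x \in A -> exists i, f i = x.
  move=> xA; exists (cast_ord An (enum_rank_in xA x)).
  by rewrite ffunE cast_ordK enum_rankK_in.
apply/imsetP; exists f; last first.
  apply/finset.setP => x; apply/idP/imsetP => [/Af[i <-]|[i _ ->]]; first by exists i; rewrite ?inE.
  exact: fA.
move: nA; rewrite negb_and => /orP[/forall_inPn[x xA]|/forall_inPn[x xA /forall_inPn[y yA]]].
  have [i fi] := Af _ xA; rewrite -leqNgt => xL.
  rewrite inE; apply/orP; left; apply/finset.bigcupP; exists i => //.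
  rewrite inE; apply/familyP => k; rewrite unfold_in /= Apos ?fA //=.
  by apply/implyP => /eqP->; rewrite fi.
have [[i fi] [j fj]] := (Af _ xA, Af _ yA); rewrite negb_imply -ltnNge => /andP[xy Qg].
have xpos := Apos _ xA.
have gN : gcdn x y < N.+1.
  by apply: leq_ltn_trans (ltn_ord x); apply: dvdn_leq => //; apply: dvdn_gcdl.
rewrite inE; apply/orP; right; apply/finset.bigcupP; exists (i, j) => /=.
  by apply: contra xy => /eqP ij; rewrite -fi ij fj.
apply/finset.bigcupP; exists (Ordinal gN) => //.
rewrite inE; apply/familyP => k; rewrite unfold_in /= Apos ?fA //=.
apply/implyP; rewrite !inE => /orP[]/eqP->; rewrite ?fi ?fj.
  exact: dvdn_gcdl.
exact: dvdn_gcdr.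
Qed.

Lemma binomial_squarefree_le : 'C(squarefree_count N, n) <= #|sparse_subsets| +
  (n * (L * N ^ n.-1) + n * n.-1 * \sum_(Q.+1 <= g < N.+1) (N %/ g) ^ 2 * N ^ n.-2).
Proof.
rewrite -card_squarefree_set -cards_draws -/squarefree_subsets.
rewrite -(cardsID sparse_subsets squarefree_subsets).
apply: leq_add; last exact: card_not_sparse.
by rewrite subset_leq_card // finset.subsetIr.
Qed.
End SparseSets.

Local Open Scope classical_set_scope.
Local Open Scope ring_scope.

(** * Multiquadratic fields *)

Lemma subfieldP (K : set algC) : subfield K <->
  [/\ K 1, forall x y, K x -> K y -> K (x - y)
    & forall x y, K x -> K y -> K (x / y)].
Proof.
split=> [[K1 KB KV]|[K1 KB KV]].
  split; first by move: K1; rewrite inE.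
    by move=> x y Kx Ky; have := KB x y; rewrite !inE; apply.
  by move=> x y Kx Ky; have := KV x y; rewrite !inE; apply.
split; first by rewrite inE.
  by move=> x y; rewrite !inE; apply: KB.
by move=> x y; rewrite !inE; apply: KV.
Qed.

Section SubfieldTheory.
Variable K : set algC.
Hypothesis fK : subfield K.

Lemma subfield1 : K 1. Proof. by have /subfieldP[] := fK. Qed.

Lemma subfieldB x y : K x -> K y -> K (x - y).
Proof. by have /subfieldP[_ + _] := fK; apply. Qed.

Lemma subfield_div x y : K x -> K y -> K (x / y).
Proof. by have /subfieldP[_ _] := fK; apply. Qed.

Lemma subfield0 : K 0.
Proof. by rewrite -(subrr 1); apply: subfieldB; apply: subfield1. Qed.

Lemma subfieldN x : K x -> K (- x).
Proof. by rewrite -sub0r; apply: subfieldB subfield0. Qed.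

Lemma subfieldD x y : K x -> K y -> K (x + y).
Proof. by move=> Kx Ky; rewrite -[y]opprK; apply: subfieldB => //; apply: subfieldN. Qed.

Lemma subfieldV x : K x -> K x^-1.
Proof. by rewrite -div1r; apply: subfield_div subfield1. Qed.

Lemma subfieldM x y : K x -> K y -> K (x * y).
Proof.
by move=> Kx Ky; rewrite -[y]invrK; apply: subfield_div => //; apply: subfieldV.
Qed.

Lemma subfield_nat n : K n%:R.
Proof.
elim: n => [|n IH]; first exact: subfield0.
by rewrite -natr1; apply: subfieldD => //; apply: subfield1.
Qed.

Lemma subfield_rat q : K (ratr q).
Proof.
have Kz (z : int) : K z%:~R.
  case: z => n; first exact: subfield_nat.
  by rewrite NegzE mulrNz; apply: subfieldN; apply: subfield_nat.
by rewrite /ratr; apply: subfield_div.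
Qed.

Lemma subfield_sum I r (P : pred I) (F : I -> algC) :
  (forall i, P i -> K (F i)) -> K (\sum_(i <- r | P i) F i).
Proof.
by move=> KF; elim/big_ind: _ => //; [exact: subfield0 | exact: subfieldD].
Qed.

Lemma subfieldX x n : K x -> K (x ^+ n).
Proof.
move=> Kx; elim: n => [|n IH]; first exact: subfield1.
by rewrite exprS; apply: subfieldM.
Qed.

End SubfieldTheory.

Lemma subfield_smallest (A : set algC) : subfield (smallest subfield A).
Proof.
apply/subfieldP; split.
- by move=> M [fM _]; apply: subfield1.
- by move=> x y Kx Ky M MA; apply: (subfieldB MA.1); [apply: Kx|apply: Ky].
- by move=> x y Kx Ky M MA; apply: (subfield_div MA.1); [apply: Kx|apply: Ky].
Qed.

(** * Fields generated by square roots *)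

Definition sqrtn (m : nat) : algC := sqrtC m%:R.

Lemma sqr_sqrtn m : sqrtn m ^+ 2 = m%:R.
Proof. exact: sqrtCK. Qed.

Lemma sqrtnM m k : sqrtn (m * k) = sqrtn m * sqrtn k.
Proof. by rewrite /sqrtn natrM sqrtCM ?nnegrE ?ler0n. Qed.

Lemma sqrtn_sqr m : sqrtn (m ^ 2) = m%:R.
Proof. by rewrite /sqrtn natrX sqrCK ?ler0n. Qed.

(** A list of generators, unlike the indexed family in [multiquadratic], permits adjoining the
    square roots one at a time by induction. *)
Definition qfield (s : seq nat) : set algC :=
  smallest subfield [set sqrtn m | m in [set` s]].

Lemma subfield_qfield s : subfield (qfield s).
Proof. exact: subfield_smallest. Qed.

Lemma mem_qfield s m : m \in s -> qfield s (sqrtn m).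
Proof. by move=> ms; apply: sub_gen_smallest; exists m. Qed.

Lemma qfield_sub s (K : set algC) : subfield K ->
  (forall m, m \in s -> K (sqrtn m)) -> qfield s `<=` K.
Proof. by move=> fK sK; apply: smallest_sub => // _ [m ms <-]; apply: sK. Qed.

Lemma qfieldS s t : {subset s <= t} -> qfield s `<=` qfield t.
Proof.
move=> st; apply: qfield_sub (subfield_qfield _) _ => m /st; exact: mem_qfield.
Qed.

Lemma eq_qfield s t : s =i t -> qfield s = qfield t.
Proof. by move=> st; apply/seteqP; split; apply: qfieldS => x; rewrite st. Qed.

Lemma multiquadratic_qfield n (a : 'I_n -> nat) :
  multiquadratic a = qfield [seq a i | i : 'I_n].
Proof.
rewrite /multiquadratic /qfield; congr smallest; apply/seteqP; split=> x /=.
  by case=> i _ <-; exists (a i) => //; apply/mapP; exists i; rewrite ?mem_enum.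
by case=> _ /mapP[i _ ->] <-; exists i.
Qed.

(** Division multiplies through by the conjugate [x' - y' * sqrtn b]. If this vanished with [y']
    nonzero, [sqrtn b] would be [x' / y'], an element of [F]. *)
Lemma subfield_adjoin_sqrtn (F : set algC) b : subfield F -> ~ F (sqrtn b) ->
  subfield [set z | exists x y, [/\ F x, F y & z = x + y * sqrtn b]].
Proof.
move=> fF nb; have bE := sqr_sqrtn b; set w := sqrtn b in nb bE *.
have Fb : F b%:R := subfield_nat fF b.
apply/subfieldP; split.
- exists 1, 0; split; rewrite ?mul0r ?addr0 //; [exact: subfield1|exact: subfield0].
- move=> _ _ [x [y [Fx Fy ->]]] [x' [y' [Fx' Fy' ->]]].
  exists (x - x'), (y - y'); split; try exact: (subfieldB fF).
  by rewrite mulrBl opprD addrACA.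
- move=> _ _ [x [y [Fx Fy ->]]] [x' [y' [Fx' Fy' ->]]].
  have [y0|y0] := eqVneq y' 0.
    rewrite y0 mul0r addr0.
    exists (x / x'), (y / x'); split; try exact: (subfield_div fF).
    by rewrite mulrDl mulrAC.
  have [z0|z0] := eqVneq (x' - y' * w) 0.
    case: nb; have -> : w = x' / y'; last exact: (subfield_div fF).
    by apply: (canRL (mulfK y0)); rewrite mulrC; apply/esym/eqP; rewrite -subr_eq0 z0.
  pose N := x' ^+ 2 - y' ^+ 2 * b%:R.
  have NE : (x' + y' * w) * (x' - y' * w) = N by rewrite /N -bE; ring.
  have FN : F N.
    by apply: (subfieldB fF); rewrite ?expr2; repeat apply: (subfieldM fF).
  exists ((x * x' - y * y' * b%:R) / N), ((y * x' - x * y') / N).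
  split; try by apply: (subfield_div fF) => //; apply: (subfieldB fF);
    repeat apply: (subfieldM fF).
  have -> : (x + y * w) / (x' + y' * w) =
      (x + y * w) * (x' - y' * w) / N.
    by rewrite -NE -mulf_div divff // mulr1.
  have -> : (x + y * w) * (x' - y' * w) =
      (x * x' - y * y' * b%:R) + (y * x' - x * y') * w by rewrite -bE; ring.
  by rewrite mulrDl; congr (_ + _); rewrite mulrAC.
Qed.

Lemma qfield_cons b s : ~ qfield s (sqrtn b) -> forall z, qfield (b :: s) z ->
  exists x y, [/\ qfield s x, qfield s y & z = x + y * sqrtn b].
Proof.
move=> nb; apply: qfield_sub; first exact: subfield_adjoin_sqrtn (subfield_qfield s) nb.
have [s0 s1] := (subfield0 (subfield_qfield s), subfield1 (subfield_qfield s)).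
move=> m; rewrite inE => /orP[/eqP->|ms].
  by exists 0, 1; split => //; rewrite mul1r add0r.
by exists (sqrtn m), 0; split => //; [exact: mem_qfield|rewrite mul0r addr0].
Qed.

(** The field is contained in the rationals, and a rational algebraic integer is an integer. *)
Lemma qfield_nil_sqrtn m : qfield [::] (sqrtn m) -> exists r, m = (r ^ 2)%N.
Proof.
have fQ : subfield [set x : algC | exists q : rat, x = ratr q].
  apply/subfieldP; split.
  - by exists 1; rewrite rmorph1.
  - by move=> _ _ [p ->] [q ->]; exists (p - q); rewrite rmorphB.
  - by move=> _ _ [p ->] [q ->]; exists (p / q); rewrite fmorph_div.
move/(qfield_sub fQ) => /(_ _)[] // q qE.
have : sqrtn m \in Num.nat.
  have mi : sqrtn m \in Num.int.
    apply: Cint_rat_Aint; first by rewrite qE Crat_rat.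
    apply: (@root_monic_Aint ('X^2 - (m%:R)%:P)).
    - by rewrite /root !hornerE sqr_sqrtn subrr.
    - by rewrite monicXnsubC.
    - apply/polyOverP => i; rewrite coefB coefXn coefC.
      by apply: rpredB; last case: ifP => _; rewrite ?natr_int ?rpred0.
  by rewrite natrEint mi sqrtC_ge0 ler0n.
case/natrP => r rE; exists r; apply/eqP; rewrite -(eqr_nat algC) natrX -rE.
by rewrite sqr_sqrtn.
Qed.

(** Induction on the generators. Squaring [sqrtn m = x + y * sqrtn b] shows that [x * y] must vanish
    when [sqrtn b] is new, since otherwise [sqrtn b] could be solved for. If [y = 0] the generator
    [b] is dropped. If [x = 0], then [sqrtn (m * b)] lies in the smaller field and [b] joins [B]. *)
Lemma sqrtn_in_qfield s m : qfield s (sqrtn m) ->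
  exists2 B, subseq B s & exists r, (m * \prod_(b <- B) b = r ^ 2)%N.
Proof.
elim: s m => [|b s IH] m.
  by move=> /qfield_nil_sqrtn[r mr]; exists [::] => //; exists r; rewrite big_nil muln1.
have fs := subfield_qfield s.
have step k : qfield s (sqrtn k) ->
    exists2 B, subseq B (b :: s) & exists r, (k * \prod_(b <- B) b = r ^ 2)%N.
  move=> /IH[B Bs Br]; exists B => //.
  exact: subseq_trans Bs (subseq_cons _ _).
have [wF|nw] := pselect (qfield s (sqrtn b)).
  move=> Km; apply: step; move: Km; apply: (qfield_sub fs) => k.
  by rewrite inE => /orP[/eqP->//|]; apply: mem_qfield.
move=> /(qfield_cons nw)[x [y [Fx Fy mE]]].
have [y0|y0] := eqVneq y 0; first by apply: step; rewrite mE y0 mul0r addr0.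
have [x0|x0] := eqVneq x 0.
  have /IH[B Bs [r rE]] : qfield s (sqrtn (m * b)).
    rewrite sqrtnM mE x0 add0r -mulrA -expr2 sqr_sqrtn.
    by apply: (subfieldM fs) => //; apply: subfield_nat.
  exists (b :: B); first by rewrite /= eqxx.
  by exists r; rewrite big_cons mulnA.
case: nw; have : m%:R = x ^+ 2 + y ^+ 2 * b%:R + 2 * x * y * sqrtn b.
  by rewrite -sqr_sqrtn mE -(sqr_sqrtn b); ring.
move=> E; have -> : sqrtn b = (m%:R - (x ^+ 2 + y ^+ 2 * b%:R)) / (2 * x * y).
  apply: (canRL (mulfK _)); first by rewrite !mulf_neq0 // pnatr_eq0.
  by rewrite E addrC addKr mulrC.
have F2 : qfield s 2 by apply: subfield_nat.
apply: (subfield_div fs); last by do 2 apply: (subfieldM fs) => //.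
apply: (subfieldB fs); first exact: (subfield_nat fs).
apply: (subfieldD fs); first exact: (subfieldX fs).
by apply: (subfieldM fs); [exact: (subfieldX fs)|exact: (subfield_nat fs)].
Qed.

(** * Orders of the Galois groups *)

(** An automorphism sends each square root to itself or to its opposite, and is determined by which
    of them it fixes. *)
Lemma card_gal_le (L : splittingFieldType rat) (iota : {rmorphism L -> algC}) s :
  range iota = qfield s -> (#|'Gal({:L} / 1)%g| <= 2 ^ size s)%N.
Proof.
move=> rE.
have xP m : {x : L | m \in s -> iota x = sqrtn m}.
  case: (boolP (m \in s)) => ms; last by exists 0.
  have /cid2[x _ xE] : range iota (sqrtn m) by rewrite rE; apply: mem_qfield.
  by exists x.
pose x_ m := sval (xP m).
have x_E m : m \in s -> iota (x_ m) = sqrtn m by rewrite /x_; case: (xP m).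
pose f (g : gal_of {:L}) := [ffun i : 'I_(size s) => g (x_ (nth 0%N s i)) == x_ (nth 0%N s i)].
have f_inj : {in 'Gal({:L} / 1)%g &, injective f}.
  move=> g h _ _ fgh; apply/eqP/gal_eqP => y _.
  have sq (k : gal_of {:L}) m : m \in s -> k (x_ m) = x_ m \/ k (x_ m) = - x_ m.
    move=> ms; have : x_ m ^+ 2 = m%:R.
      by apply: (fmorph_inj iota); rewrite rmorphXn /= x_E // sqr_sqrtn rmorph_nat.
    move=> E; have : (k (x_ m)) ^+ 2 = x_ m ^+ 2.
      by rewrite -rmorphXn /= E rmorph_nat.
    by move/eqP; rewrite eqf_sqr => /orP[]/eqP; [left|right].
  (* The elements on which [g] and [h] agree form a subfield. It contains the generators, hence
     everything. *)
  have fM : subfield [set iota x | x in [set x | g x = h x]].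
    apply/subfieldP; split.
    - by exists 1; rewrite /= ?rmorph1.
    - move=> _ _ [a /= ga <-] [b /= gb <-]; exists (a - b); rewrite /= ?rmorphB //.
      by rewrite /= ga gb.
    - move=> _ _ [a /= ga <-] [b /= gb <-]; exists (a / b); rewrite /= ?fmorph_div //.
      by rewrite /= ga gb.
  have : qfield s (iota y) by rewrite -rE; exists y.
  move/(qfield_sub fM) => /(_ _)[]; last by move=> z /= gz /fmorph_inj <-.
  move=> m ms; exists (x_ m); last exact: x_E.
  have ims : (index m s < size s)%N by rewrite index_mem.
  have /ffunP/(_ (Ordinal ims)) := fgh; rewrite !ffunE /= nth_index //.
  case: (sq g m ms) => ->; case: (sq h m ms) => -> //; rewrite eqxx.
    by move/esym/eqP/esym.
  by move/eqP.
rewrite -(card_in_imset f_inj) (leq_trans (max_card _)) //.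
by rewrite card_ffun card_bool card_ord.
Qed.

(** Elements of an adjunction are iterated polynomials in the generators over the rationals. This
    transfers adjunction inside [L] to subfields of [algC]. *)
Lemma mem_adjoin_seq_subfield (L : fieldExtType rat) (iota : {rmorphism L -> algC})
    (K : set algC) (t : seq L) : subfield K -> (forall x, x \in t -> K (iota x)) ->
  forall y, y \in <<1 & t>>%VS -> K (iota y).
Proof.
move=> fK; elim/last_ind: t => [|t x IH] Kt y.
  rewrite adjoin_nil (subfield_closed 1%AS) => /vlineP[q ->].
  by rewrite rmorphZ_num rmorph1 mulr1; apply: subfield_rat.
rewrite adjoin_rcons.
have Kt' z : z \in t -> K (iota z) by move=> zt; apply: Kt; rewrite mem_rcons inE zt orbT.
case/Fadjoin_polyP => p /polyOverP pt ->.
rewrite -horner_map horner_coef; apply: subfield_sum => // i _.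
apply: subfieldM => //; first by rewrite coef_map; apply: IH Kt' _ (pt i).
by apply: subfieldX => //; apply: Kt; rewrite mem_rcons mem_head.
Qed.

(** Each square root lies outside the field of those after it in the list, so adjoining it at least
    doubles the dimension. The list is reversed because [adjoin_rcons] adjoins the last entry. *)
Lemma dim_adjoin_qfield (L : fieldExtType rat) (iota : {rmorphism L -> algC})
    (s : seq nat) (t : seq L) : map iota t = map sqrtn s ->
  (forall b v, suffix (b :: v) s -> ~ qfield v (sqrtn b)) ->
  (2 ^ size s <= \dim <<1 & t>>)%N.
Proof.
move=> ts ind.
have step : forall u v, suffix v s -> map iota u = map sqrtn v ->
    (2 ^ size v <= \dim <<1 & rev u>>)%N.
  elim=> [|x u IH] [|b v] //= vs.
    by rewrite adjoin_nil (subfield_closed 1%AS) dimv1.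
  case=> xb uv; rewrite rev_cons adjoin_rcons dim_Fadjoin expnS.
  have vs' : suffix v s by apply: suffix_trans vs; apply: (suffix_suffix [:: b]).
  apply: leq_mul (IH v vs' uv).
  rewrite ltn_neqAle eq_sym adjoin_deg_eq1 lt0n -[adjoin_degree _ _]prednK //= andbT.
  apply/negP => xu; apply: (ind b v vs); rewrite -xb.
  apply: (mem_adjoin_seq_subfield (subfield_qfield v) _ xu) => y.
  rewrite mem_rev => yu; have : iota y \in map iota u by apply: map_f.
  by rewrite uv => /mapP[m mv ->]; apply: mem_qfield.
have := step t s (suffix_refl _) ts; congr (_ <= \dim _)%N.
apply: subv_anti; apply/andP; split; apply: adjoin_seqSr => x; by rewrite mem_rev.
Qed.

(** The number field generated by the square roots is the splitting field of the product of the
    [X^2 - x^2]. In characteristic 0 it is therefore Galois, and the group order is its dimension,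
    which is bounded below by the successive doublings. *)
Lemma gal_order_qfield s :
  (forall b v, suffix (b :: v) s -> ~ qfield v (sqrtn b)) ->
  gal_order (qfield s) (2 ^ size s).
Proof.
move=> ind; have [Qs [QsC [t ts genQ]]] := num_field_exists (map sqrtn s).
have tsq x : x \in t -> exists m : nat, x ^+ 2 = m%:R.
  move=> xt; have : QsC x \in map QsC t by apply: map_f.
  rewrite ts => /mapP[m ms xm]; exists m; apply: (fmorph_inj QsC).
  by rewrite rmorphXn /= xm sqr_sqrtn rmorph_nat.
pose p : {poly Qs} := \prod_(x <- t) ('X^2 - (x ^+ 2)%:P).
have p1 : p \is a polyOver 1%VS.
  rewrite /p big_seq; apply: rpred_prod => x /tsq[m ->].
  by apply: rpredB; rewrite ?rpredX ?polyOverX // polyOverC rpred_nat.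
have splitp : splittingFieldFor 1 p {:Qs}.
  exists (t ++ map -%R t); last first.
    apply/eqP; rewrite eqEsubv subvf -genQ adjoin_seqSr // => x xt.
    by rewrite mem_cat xt.
  suff -> : p = \prod_(x <- t ++ map -%R t) ('X - x%:P) by apply: eqpxx.
  rewrite big_cat /= big_map -big_split /=; apply: eq_bigr => x _.
  by rewrite polyCN opprK rmorphXn subr_sqr.
have Q_ax : FieldExt_isSplittingField _ Qs by constructor; exists p.
pose L : splittingFieldType rat := HB.pack_for (splittingFieldType rat) Qs Q_ax.
pose iota : {rmorphism L -> algC} := QsC.
have rE : range iota = qfield s.
  apply/seteqP; split.
    move=> _ [y _ <-].
    have : y \in <<1 & t>>%VS by rewrite genQ memvf.
    apply: (mem_adjoin_seq_subfield (subfield_qfield s)) => x xt.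
    have : QsC x \in map QsC t by apply: map_f.
    by rewrite ts => /mapP[m ms ->]; apply: mem_qfield.
  apply: qfield_sub.
    apply/subfieldP; split.
    - by exists 1; rewrite ?rmorph1.
    - by move=> _ _ [a _ <-] [b _ <-]; exists (a - b); rewrite ?rmorphB.
    - by move=> _ _ [a _ <-] [b _ <-]; exists (a / b); rewrite ?fmorph_div.
  move=> m ms; have : sqrtn m \in map QsC t by rewrite ts map_f.
  by case/mapP => x xt ->; exists x.
exists L, iota; split => //.
apply/eqP; rewrite eqn_leq (card_gal_le rE) /=.
rewrite -galois_dim.
  by have := dim_adjoin_qfield ts ind; rewrite genQ dimv1 divn1.
apply/and3P; split; [exact: sub1v | | exact: normalFieldf].
apply/separableP => x _; apply: pcharf0_separable => q.
by rewrite -(fmorph_pchar iota) pchar_num.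
Qed.

(** * The density of squarefree integers *)

Section SquarefreeDensity.
Variable R : realType.

Definition zeta2_partial (D : nat) : R := \sum_(1 <= d < D.+1) (d%:R ^+ 2)^-1.

Lemma zeta2_partialS D : zeta2_partial D.+1 = zeta2_partial D + (D.+1%:R ^+ 2)^-1.
Proof. by rewrite /zeta2_partial big_nat_recr. Qed.

Lemma le_zeta2_partial m D : (m <= D)%N -> zeta2_partial m <= zeta2_partial D.
Proof.
move=> mD; rewrite -(subnKC mD); elim: (D - m)%N => [|k IH]; first by rewrite addn0.
by rewrite addnS zeta2_partialS (le_trans IH) // lerDl invr_ge0 exprn_ge0.
Qed.

(** Telescoping, from [1 / (k + 1)^2 <= 1 / k - 1 / (k + 1)]. *)
Lemma zeta2_partial_tail m D : (0 < m)%N ->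
  zeta2_partial D <= zeta2_partial m + m%:R^-1.
Proof.
move=> m0; have [Dm|/ltnW mD] := leqP D m.
  by rewrite (le_trans (le_zeta2_partial Dm)) // lerDl invr_ge0.
rewrite -(subnKC mD); move: (D - m)%N => k.
suff : zeta2_partial (m + k) <= zeta2_partial m + m%:R^-1 - (m + k)%:R^-1.
  by move/le_trans; apply; rewrite gerBl invr_ge0.
elim: k => [|k IH]; first by rewrite addn0 addrK.
rewrite addnS zeta2_partialS; move: IH; set x := (m + k)%:R : R.
have x0 : 0 < x by rewrite ltr0n addn_gt0 m0.
have -> : ((m + k).+1%:R = x + 1 :> R) by rewrite -natr1.
suff : ((x + 1) ^+ 2)^-1 <= x^-1 - (x + 1)^-1 by lra.
have -> : x^-1 - (x + 1)^-1 = (x * (x + 1))^-1 by field; lra.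
by rewrite lef_pV2 ?posrE ?mulr_gt0 ?exprn_gt0 //; nra.
Qed.

Lemma zeta2_bounds m : (0 < m)%N ->
  zeta2_partial m <= zeta (2 : R) <= zeta2_partial m + m%:R^-1.
Proof.
move=> m0.
have -> : zeta (2 : R) = limn zeta2_partial.
  rewrite /zeta; congr (lim (_ @ \oo)); apply/funext => n.
  rewrite /series /= /zeta2_partial big_add1 /=; apply: eq_bigr => k _.
  by rewrite powRN (powR_mulrn 2).
have homo : {homo zeta2_partial : n m / (n <= m)%N >-> n <= m}.
  exact: le_zeta2_partial.
have cv : cvgn zeta2_partial.
  apply: nondecreasing_is_cvgn => //; exists (zeta2_partial m + m%:R^-1).
  by move=> _ [D _ <-]; apply: zeta2_partial_tail.
apply/andP; split; first exact: nondecreasing_cvgn_le.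
by apply: limr_le => //; apply: nearW => D; apply: zeta2_partial_tail.
Qed.

Lemma zeta2_ge1 : 1 <= zeta (2 : R).
Proof.
have /andP[+ _] := zeta2_bounds (isT : (0 < 1)%N); apply: le_trans.
by rewrite /zeta2_partial big_nat1 expr1n invr1.
Qed.

(** The induction on the error term needs an exponent below 1 for which the sum of [d ^ (- 2 theta)]
    over [d >= 2] is less than 1. *)
Definition theta : R := 47 / 48.

(** With [t = sqrt d] the left side is [d^-2 * t ^ (1/12)]. Young's inequality with exponents 12 and
    12/11 gives [t ^ (1/12) <= t / 12 + 11/12]. *)
Lemma powR_theta_weight (d : nat) : (0 < d)%N ->
  ((d%:R ^+ 2) `^ theta)^-1 <= (d%:R ^+ 2)^-1 * (1 + Num.sqrt d%:R / 12) :> R.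
Proof.
move=> d0; set t := Num.sqrt (d%:R : R).
have t0 : 0 < t by rewrite sqrtr_gt0 ltr0n.
have dE : d%:R = t ^+ 2 by rewrite sqr_sqrtr.
have -> : (d%:R ^+ 2) `^ theta = d%:R ^+ 2 / (t `^ (12^-1)) :> R.
  rewrite dE -exprM -(powR_mulrn _ (ltW t0)) -powRrM.
  have -> : (2 * 2)%:R * theta = (2 * 2)%:R - 12^-1.
    by rewrite /theta; field.
  by rewrite powRD ?powRN //; rewrite lt0r_neq0 ?implybT.
rewrite invf_div mulrC ler_wpM2l ?invr_ge0 ?exprn_ge0 //.
have p0 : (0 : R) < 12 by [].
have q0 : (0 : R) < 12 / 11 by rewrite divr_gt0.
have := @conjugate_powR R (t `^ 12^-1) 1 12 (12/11) (powR_ge0 _ _) ler01 p0 q0.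
rewrite -powRrM powR1 mulr1 mulVf // powRr1 ?(ltW t0) //.
move=> /(_ _); suff -> : 12^-1 + (12 / 11)^-1 = 1 :> R by move/(_ erefl); lra.
by field.
Qed.

(** For [s] and [t] the square roots of [d - 1] and [d], this makes the sum of [d ^ (- 3/2)]
    telescope. *)
Lemma inv_sqrt_telescope (s t : R) : 0 < s -> 0 < t -> t ^+ 2 = s ^+ 2 + 1 ->
  (t ^+ 3)^-1 <= 2 * (s^-1 - t^-1).
Proof.
move=> s0 t0 ts; have st : s < t by nra.
have -> : s^-1 - t^-1 = ((t + s) * (s * t))^-1.
  have e : (t - s) * (t + s) = 1 by nra.
  by rewrite -[RHS]mul1r -e; field; lra.
have -> : 2 * ((t + s) * (s * t))^-1 = ((t + s) * (s * t) / 2)^-1.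
  by field; lra.
by rewrite lef_pV2 ?posrE; [nra| |]; rewrite ?divr_gt0 ?mulr_gt0 ?exprn_gt0 ?addr_gt0.
Qed.

Lemma sum_theta_weight D :
  \sum_(2 <= d < D.+1) ((d%:R ^+ 2) `^ theta)^-1 <= 5 / 6 :> R.
Proof.
(* The terms [d^-2] telescope through [1 / (d - 1/2) - 1 / (d + 1/2)], with total at most 2/3, and
   the terms [d ^ (- 3/2)] have total at most 2, so the bound is 2/3 + 2/12 = 5/6. Without the
   half-integer shift the first total would be bounded by 1, which is too much. *)
suff H : forall D, \sum_(2 <= d < D.+2) ((d%:R ^+ 2) `^ theta)^-1 <=
    (2 / 3 - (D.+1%:R + 2^-1)^-1) + (2 - 2 / Num.sqrt D.+1%:R) / 12 :> R.
  case: D => [|D]; first by rewrite big_geq //; lra.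
  apply: (le_trans (H D)).
  have : 0 <= (D.+1%:R + 2^-1)^-1 :> R by rewrite invr_ge0 addr_ge0.
  have : 0 <= 2 / Num.sqrt D.+1%:R :> R by rewrite divr_ge0.
  by lra.
elim=> [|k IH].
  have -> : (1%:R + 2^-1)^-1 = 2 / 3 :> R by field.
  by rewrite big_geq // sqrtr1; lra.
rewrite big_nat_recr //=.
have := @powR_theta_weight k.+2 isT; move: IH.
set W := ((_ `^ _)^-1); set S := \sum_(_ <= _ < _) _.
set x := (k.+1%:R : R); have x1 : 1 <= x by rewrite ler1n.
have -> : (k.+2%:R = x + 1 :> R) by rewrite -natr1.
set s := Num.sqrt x; set t := Num.sqrt (x + 1).
have s0 : 0 < s by rewrite sqrtr_gt0; lra.
have t0 : 0 < t by rewrite sqrtr_gt0; lra.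
have sE : s ^+ 2 = x by rewrite sqr_sqrtr //; lra.
have tE : t ^+ 2 = x + 1 by rewrite sqr_sqrtr //; lra.
have := @inv_sqrt_telescope s t s0 t0; rewrite sE => /(_ tE).
have -> : (t ^+ 3)^-1 = t / (x + 1) ^+ 2.
  by rewrite -tE; field; lra.
have : ((x + 1) ^+ 2)^-1 <= (x + 2^-1)^-1 - (x + 1 + 2^-1)^-1.
  have -> : (x + 2^-1)^-1 - (x + 1 + 2^-1)^-1 = ((x + 2^-1) * (x + 1 + 2^-1))^-1.
    by field; lra.
  by rewrite lef_pV2 ?posrE; [nra| |]; rewrite ?mulr_gt0 ?exprn_gt0; lra.
set a := ((x + 1) ^+ 2)^-1; set b := (x + 2^-1)^-1.
set c := (x + 1 + 2^-1)^-1; lra.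
Qed.

Lemma truncn_div_nat (x : R) (d : nat) : 0 <= x -> (0 < d)%N ->
  Num.truncn (x / d%:R) = (Num.truncn x %/ d)%N.
Proof.
move=> x0 d0; have d0' : (0 : R) < d%:R by rewrite ltr0n.
apply: truncn_def; rewrite ler_pdivlMr // ltr_pdivrMr // -!natrM.
rewrite -truncn_ge_nat // -truncn_lt_nat // leq_trunc_div /=.
exact: ltn_ceil.
Qed.
End SquarefreeDensity.

(** * The error term for squarefree integers *)

Section SquarefreeCount.
Variable R : realType.

Let c : R := (zeta (2 : R))^-1.
Let e (x : R) : R := (squarefree_count (Num.truncn x))%:R - c * x.

Let c_ge0 : 0 <= c.
Proof. by rewrite invr_ge0 (le_trans _ (zeta2_ge1 R)). Qed.

Let c_le1 : c <= 1.
Proof. by rewrite invf_le1 ?zeta2_ge1 // (lt_le_trans _ (zeta2_ge1 R)). Qed.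

(** By [sum_squarefree_count] the sum is [floor x] minus [c * x] times a partial sum of [zeta 2].
    Completing that partial sum turns the product into [x], at a cost of at most
    [c * x / D <= 1]. *)
Let sum_error (x : R) (D : nat) : 1 <= x -> (Num.truncn x < D)%N ->
  `| \sum_(1 <= d < D.+1) e (x / d%:R ^+ 2) | <= 2.
Proof.
move=> x1 xD; have x0 : 0 <= x by lra.
have D0 : (0 < D)%N by apply: leq_ltn_trans xD.
have -> : \sum_(1 <= d < D.+1) e (x / d%:R ^+ 2) =
    (Num.truncn x)%:R - c * x * zeta2_partial R D.
  rewrite /e big_split /= sumrN -(sum_squarefree_count (ltnW xD)) natr_sum.
  congr (_ - _); last by rewrite mulr_sumr; apply: eq_bigr => d _; rewrite mulrA.
  apply: eq_big_nat => d /andP[d1 _]; rewrite -natrX truncn_div_nat //.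
  by rewrite expn_gt0 d1.
have /andP[zl zu] := zeta2_bounds R D0.
have /andP[tl tu] := truncn_itv x0.
have xDr : x <= D%:R by rewrite ltW // (lt_le_trans tu) // ler_nat.
have cz : c * zeta (2 : R) = 1.
  by rewrite mulVf // gt_eqF // (lt_le_trans _ (zeta2_ge1 R)).
have cxz : c * x * zeta (2 : R) = x by rewrite mulrAC cz mul1r.
have cx0 : 0 <= c * x by rewrite mulr_ge0.
have u1 : c * x * zeta (2 : R) <= c * x * zeta2_partial R D + 1.
  apply: (le_trans (ler_wpM2l cx0 zu)); rewrite mulrDr lerD2l.
  rewrite ler_pdivrMr ?ltr0n // mul1r (le_trans _ xDr) //.
  by rewrite -[leRHS]mul1r ler_wpM2r.
have u2 := ler_wpM2l cx0 zl.
rewrite -natr1 in tu; rewrite ler_norml; apply/andP; split; lra.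
Qed.

(* [e x = O(1) - \sum_(d >= 2) e (x / d^2)], so a bound [K * x ^ theta]
   propagates because the weights [d ^ (- 2 theta)], [d >= 2], sum to less
   than [1]. *)
Lemma squarefree_count_estimate (x : R) : 0 <= x ->
  `| (squarefree_count (Num.truncn x))%:R - (zeta (2 : R))^-1 * x |
    <= 12 * x `^ theta R.
Proof.
rewrite -[X in `|X|]/(e x).
have [k] := ubnP (Num.truncn x); elim: k x => // k IH x xk x0.
(* Below 1 no squarefree integer is counted, and [c * x <= x <= x ^ theta]. *)
have [x1|x1] := leP 1 x; last first.
  have -> : e x = - (c * x).
    have /truncn0Pn E : ~~ (1 <= x) by rewrite -ltNge.
    by rewrite /e E /squarefree_count big_ord1 sub0r.
  rewrite normrN ger0_norm ?mulr_ge0 //.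
  have [->|xn0] := eqVneq x 0; first by rewrite mulr0 mulr_ge0 ?powR_ge0.
  have xx : x <= x `^ theta R.
    by apply: ger1_powR; rewrite ?lt_neqAle ?(ltW x1) ?andbT 1?eq_sym ?xn0 ?x0 // /theta; lra.
  have cx : c * x <= x by rewrite -[leRHS]mul1r ler_wpM2r.
  by apply: (le_trans cx); apply: (le_trans xx); have := powR_ge0 x (theta R); lra.
set D := (Num.truncn x).+1.
have := sum_error x1 (ltnSn _); rewrite -/D big_ltn // expr1n divr1.
set S := \sum_(2 <= d < _) _ => H.
have SB : `|S| <= 12 * x `^ theta R * (5 / 6).
  apply: (le_trans (ler_norm_sum _ _ _)).
  have w0 : 0 <= 12 * x `^ theta R by rewrite mulr_ge0 ?powR_ge0.
  apply: le_trans (ler_wpM2l w0 (sum_theta_weight R D)).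
  rewrite mulr_sumr; apply: ler_sum_nat => d /andP[d2 _].
  have d0 : (0 : R) < d%:R by rewrite ltr0n (leq_trans _ d2).
  have d20 : (0 : R) <= d%:R ^+ 2 by rewrite exprn_ge0 ?(ltW d0).
  have : `|e (x / d%:R ^+ 2)| <= 12 * (x / d%:R ^+ 2) `^ theta R.
    apply: IH; last by rewrite divr_ge0.
    rewrite -natrX truncn_div_nat ?expn_gt0 ?(leq_trans _ d2) //.
    have t1 : (0 < Num.truncn x)%N by rewrite truncn_gt0.
    rewrite -ltnS; apply: leq_trans xk; rewrite ltnS ltn_Pdiv //.
    by rewrite -mulnn; nia.
  move/le_trans; apply; rewrite powRM ?invr_ge0 // -powR_inv1 // -powRrM mulrC.
  by rewrite mulN1r powRN mulrC mulrA.
(* The constant 12 closes the induction: [2 + 12 * (5/6) * x ^ theta] is at most [12 * x ^ theta] as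
   soon as [x ^ theta >= 1]. *)
have xt1 : 1 <= x `^ theta R.
  have E : 1 `^ theta R = 1 by rewrite powR1.
  by rewrite -[leLHS]E ge0_ler_powR ?nnegrE ?ler01 // /theta; lra.
move: H SB; rewrite !ler_norml => /andP[? ?] /andP[? ?].
by apply/andP; split; lra.
Qed.
End SquarefreeCount.

(** * Counting multiquadratic fields *)

Definition ord_seq N (A : {set 'I_N.+1}) : seq nat := [seq val i | i <- enum A].

Lemma mem_ord_seq N (A : {set 'I_N.+1}) (x : 'I_N.+1) :
  (val x \in ord_seq A) = (x \in A).
Proof. by rewrite mem_map ?mem_enum //; apply: val_inj. Qed.

Lemma ord_seqP N (A : {set 'I_N.+1}) m : m \in ord_seq A ->
  exists2 x : 'I_N.+1, x \in A & m = val x.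
Proof. by case/mapP => x; rewrite mem_enum; exists x. Qed.

Lemma size_ord_seq N (A : {set 'I_N.+1}) : size (ord_seq A) = #|A|.
Proof. by rewrite size_map -cardE. Qed.

Lemma uniq_ord_seq N (A : {set 'I_N.+1}) : uniq (ord_seq A).
Proof. by rewrite map_inj_uniq ?enum_uniq //; apply: val_inj. Qed.

Section CountFields.
Variables (R : realType) (n : nat) (H : R).
Hypothesis H0 : 0 <= H.
Local Notation N := (Num.truncn H).

(** Replacing each [a i] by its squarefree part changes its square root by a nonzero integer factor,
    so the field is unchanged. *)
Lemma multiquadratic_fields_squarefree K : multiquadratic_fields n H K ->
  exists2 A, A \in squarefree_subsets n N & qfield (ord_seq A) = K.
Proof.
case=> a [aH KE [L [iota [rE galE]]]].
have bP i : exists sd : nat * nat, squarefree sd.1 /\ a i = (sd.1 * sd.2 ^ 2)%N.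
  have [s [d [sf _ aE]]] := squarefree_decomposition (aH i).1.
  by exists (s, d).
have [sd sdP] := choice bP.
pose s := undup [seq (sd i).1 | i : 'I_n].
have sN m : m \in s -> squarefree m /\ (m < N.+1)%N.
  rewrite mem_undup => /mapP[i _ ->]; have [sf aE] := sdP i; split=> //.
  have [a1 aleH] := aH i; rewrite ltnS truncn_ge_nat // (le_trans _ aleH) //.
  by rewrite ler_nat aE leq_pmulr // lt0n; apply: contraTneq a1 => d0; rewrite aE d0 muln0.
have Ks : K = qfield s.
  rewrite KE multiquadratic_qfield; apply/seteqP.
  split; (apply: qfield_sub => [|m]; first exact: subfield_qfield).
  - case/mapP => i _ ->; have [_ ->] := sdP i; rewrite sqrtnM sqrtn_sqr.
    apply: (subfieldM (subfield_qfield s)); last exact: subfield_nat (subfield_qfield s) _.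
    by apply: mem_qfield; rewrite mem_undup; apply/mapP; exists i; rewrite ?mem_enum.
  - rewrite mem_undup => /mapP[i _ ->]; have [_ aE] := sdP i.
    set F := qfield _; have fF : subfield F by apply: subfield_qfield.
    have : F (sqrtn (a i)) by apply: mem_qfield; apply/mapP; exists i; rewrite ?mem_enum.
    rewrite aE sqrtnM sqrtn_sqr => Fa.
    have d0 : (sd i).2%:R != 0 :> algC.
      rewrite pnatr_eq0; apply/negP => /eqP d0.
      by have := (aH i).1; rewrite aE d0 muln0.
    rewrite -(mulfK d0 (sqrtn _)); apply: (subfield_div fF) => //.
    exact: subfield_nat.
pose A : {set 'I_N.+1} := [set x : 'I_N.+1 | val x \in s]%SET.
have As : ord_seq A =i s.
  move=> m; apply/idP/idP => [/ord_seqP[x + ->]|ms]; first by rewrite inE.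
  have [_ mN] := sN m ms; rewrite -[m]/(val (Ordinal mN)) mem_ord_seq.
  by rewrite inE.
(* Fewer than [n] distinct squarefree parts would make the Galois group smaller than [2 ^ n]. *)
have szs : size s = n.
  apply/eqP; rewrite eqn_leq; apply/andP; split.
    by rewrite (leq_trans (size_undup _)) // size_map -cardE card_ord.
  by rewrite -(leq_exp2l (m := 2)) // -galE; apply: (card_gal_le (iota := iota)); rewrite rE.
exists A; last by rewrite Ks; apply: eq_qfield.
rewrite inE -size_ord_seq -szs.
have -> : size (ord_seq A) = size s.
  by apply/eqP; rewrite -(uniq_size_uniq (undup_uniq _)) ?uniq_ord_seq // => m; rewrite As.
rewrite eqxx andbT; apply/fintype.subsetP => x; rewrite !inE => /sN[].
by [].
Qed.

Lemma G_le : (G n H <= 'C(squarefree_count N, n))%N.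
Proof.
rewrite -card_squarefree_set -cards_draws -/(squarefree_subsets n N) cardE.
rewrite -(size_map (fun A => qfield (ord_seq A))).
apply: uniq_leq_size; first exact: fset_uniq.
move=> K; rewrite in_fset_set; last exact: finite_multiquadratic_fields.
rewrite inE => /multiquadratic_fields_squarefree[A AX <-].
by apply/mapP; exists A; rewrite ?mem_enum.
Qed.

Variables L Q : nat.
Hypothesis L0 : (0 < L)%N.
Hypothesis NQL : (N * Q ^ (2 * n).-1 < L ^ 2)%N.

Lemma sparse_ord_seq A : A \in sparse_subsets n N L Q ->
  [/\ sparse L Q (ord_seq A), size (ord_seq A) = n
    & forall m, m \in ord_seq A -> squarefree m /\ (1 < m <= N)%N].
Proof.
rewrite 2!inE -andbA => /and4P[/fintype.subsetP AS /eqP An /forall_inP AL /forall_inP AQ].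
have ASF m : m \in ord_seq A -> squarefree m.
  by case/ord_seqP => x /AS + ->; rewrite inE.
have ALm m : m \in ord_seq A -> (L < m)%N by case/ord_seqP => x /AL + ->.
split; [split => //; first exact: uniq_ord_seq | by rewrite size_ord_seq |].
  move=> x y /ord_seqP[i iA ->] /ord_seqP[j jA ->] ij.
  by have /forall_inP/(_ _ jA)/implyP := AQ _ iA; apply.
move=> m mA; split; first exact: ASF.
rewrite (leq_ltn_trans L0 (ALm _ mA)) /=.
by case/ord_seqP: mA => x _ ->; rewrite -ltnS; apply: ltn_ord.
Qed.

(** Taking for [v] the tails of [ord_seq A] gives the independence of the square roots. Taking the
    whole list shows that the field determines [A]. *)
Lemma sparse_sqrtn_mem A m : A \in sparse_subsets n N L Q ->
  squarefree m -> (1 < m <= N)%N -> forall v, subseq v (ord_seq A) ->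
  qfield v (sqrtn m) -> m \in v.
Proof.
move=> /sparse_ord_seq[spA szA _] sm mN v vA /sqrtn_in_qfield[B Bv [r rE]].
have BE : B = [:: m].
  by apply: (sparse_square_product L0 spA _ NQL (subseq_trans Bv vA) sm mN rE); rewrite szA.
by rewrite -sub1seq -BE.
Qed.

Lemma sparse_subsets_fields A : A \in sparse_subsets n N L Q ->
  multiquadratic_fields n H (qfield (ord_seq A)).
Proof.
move=> AX; have [[uA _ _ _] szA mA] := sparse_ord_seq AX.
exists (fun i : 'I_n => nth 0%N (ord_seq A) i); split.
- move=> i; have : nth 0%N (ord_seq A) i \in ord_seq A by rewrite mem_nth ?szA.
  case/mA => _ /andP[m1 mN]; split; first exact: ltnW.
  by rewrite -truncn_ge_nat.
- rewrite multiquadratic_qfield; congr qfield.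
  apply: (@eq_from_nth _ 0%N); first by rewrite szA size_map size_enum_ord.
  move=> i; rewrite szA => ilt; rewrite (nth_map (Ordinal ilt)) ?size_enum_ord //.
  by rewrite nth_enum_ord.
rewrite -szA; apply: gal_order_qfield => b v bv.
have bvs : subseq (b :: v) (ord_seq A) by case/suffixP: bv => u ->; apply: suffix_subseq.
have [sb bN] := mA b (mem_subseq bvs (mem_head _ _)).
have vs : subseq v (ord_seq A) := subseq_trans (subseq_cons v b) bvs.
move=> /(sparse_sqrtn_mem AX sb bN vs) bv'.
by have := subseq_uniq bvs uA; rewrite /= bv'.
Qed.

Lemma sparse_subsets_inj :
  {in sparse_subsets n N L Q &, injective (fun A => qfield (ord_seq A))}.
Proof.
suff sub A B : A \in sparse_subsets n N L Q -> B \in sparse_subsets n N L Q ->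
    qfield (ord_seq A) = qfield (ord_seq B) -> A \subset B.
  move=> A B AX BX E; apply/eqP; rewrite finset.eqEsubset.
  by rewrite (sub A B) // (sub B A).
move=> AX BX E; apply/fintype.subsetP => x xA; rewrite -mem_ord_seq.
have [_ _ mA] := sparse_ord_seq AX.
have xA' : val x \in ord_seq A by rewrite mem_ord_seq.
have [sx xN] := mA _ xA'.
by apply: (sparse_sqrtn_mem BX sx xN (subseq_refl _)); rewrite -E; apply: mem_qfield.
Qed.

Lemma G_ge : (#|sparse_subsets n N L Q| <= G n H)%N.
Proof.
rewrite cardE -(size_map (fun A => qfield (ord_seq A))).
apply: uniq_leq_size.
  rewrite map_inj_in_uniq ?enum_uniq // => A B; rewrite !mem_enum.
  exact: sparse_subsets_inj.
move=> _ /mapP[A + ->]; rewrite mem_enum => AX.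
rewrite in_fset_set; last exact: finite_multiquadratic_fields.
by rewrite inE; apply: sparse_subsets_fields.
Qed.
End CountFields.

(** * Estimates *)

Lemma ffact_le_expn S k : (S ^_ k <= S ^ k)%N.
Proof.
elim: k => [|k IH]; first by rewrite ffactn0.
by rewrite ffactnSr expnSr leq_mul // leq_subr.
Qed.

(** Replacing one factor [S - k] by [S] costs at most [k * S ^ k], also when the subtraction
    truncates. This compares [n]! times the binomial coefficient with [S ^ n]. *)
Lemma expn_ffact_le S k : (S ^ k <= S ^_ k + k ^ 2 * S ^ k.-1)%N.
Proof.
elim: k => [|k IH]; first by rewrite ffactn0 expn0.
rewrite expnSr ffactnSr.
have le1 := ffact_le_expn S k.
have le2 : (S ^_ k * S <= S ^_ k * (S - k) + k * S ^ k)%N.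
  apply: (@leq_trans (S ^_ k * (S - k + k))); first by rewrite leq_mul2l; lia.
  by rewrite mulnDr leq_add2l mulnC leq_mul2l le1 orbT.
have le3 : (k ^ 2 * S ^ k.-1 * S <= k ^ 2 * S ^ k)%N.
  by case: (k) => [|k'] //; rewrite -mulnA -expnSr.
have := leq_mul IH (leqnn S); rewrite mulnDl /=; nia.
Qed.

Lemma squarefree_count_le N : (squarefree_count N <= N)%N.
Proof.
rewrite /squarefree_count big_ord_recl /= add0n.
rewrite (leq_trans (n := \sum_(i < N) 1)%N) //; first by apply: leq_sum => i _; case: squarefree.
by rewrite sum_nat_const card_ord muln1.
Qed.

Section Estimate.
Variable R : realType.

Lemma dist_expr_le (a b M : R) n : 0 <= a <= M -> 0 <= b <= M ->
  `|a ^+ n - b ^+ n| <= n%:R * M ^+ n.-1 * `|a - b|.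
Proof.
move=> /andP[a0 aM] /andP[b0 bM]; have M0 := le_trans a0 aM.
rewrite subrXX mulrC normrM ler_wpM2r // (le_trans (ler_norm_sum _ _ _)) //.
rewrite mulr_natl -[X in _ *+ X](card_ord n) -sumr_const; apply: ler_sum => i _.
have ni : (n.-1 = n.-1 - i + i)%N by have := ltn_ord i; lia.
rewrite [in leRHS]ni exprD ger0_norm; last by rewrite mulr_ge0 ?exprn_ge0.
by apply: ler_pM; rewrite ?exprn_ge0 // lerXn2r ?nnegrE.
Qed.

Lemma sum_divn_sq_le (N Q : nat) : (0 < Q)%N ->
  (\sum_(Q.+1 <= g < N.+1) (N %/ g) ^ 2)%:R <= N%:R ^+ 2 / Q%:R :> R.
Proof.
move=> Q0; have [NQ|QN] := leqP N Q; first by rewrite big_geq // divr_ge0 ?exprn_ge0.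
have := zeta2_partial_tail R N Q0.
rewrite /zeta2_partial (@big_cat_nat _ _ _ Q.+1) //=; last exact: ltnW.
rewrite lerD2l => tail; rewrite natr_sum.
apply: le_trans (ler_wpM2l (exprn_ge0 2 (ler0n R N)) tail).
rewrite mulr_sumr; apply: ler_sum_nat => g /andP[gQ _].
have g0 : (0 : R) < g%:R by rewrite ltr0n (leq_trans _ gQ).
rewrite natrX -exprVn -exprMn lerXn2r ?nnegrE ?divr_ge0 //.
by rewrite ler_pdivlMr // -natrM ler_nat leq_trunc_div.
Qed.

(** With [y = ln H], the bound [ln y <= 2 * sqrt y] gives [y * ln y / 2 <= y ^ (3/2)], and this is
    at most [(d * y) ^ 2] once [y >= d ^ (- 4)]. *)
Lemma powR_le_expR_sqrt (d H : R) : 0 < d -> expR (d ^- 4) <= H ->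
  H `^ (- d) <= expR (- Num.sqrt (ln H * ln (ln H) / 2)).
Proof.
move=> d0 Hd; have H0 : 0 < H by apply: lt_le_trans Hd; apply: expR_gt0.
rewrite /powR gt_eqF // ler_expR mulNr lerN2.
have : d ^- 4 <= ln H by rewrite -[leLHS]expRK ler_ln ?posrE ?expR_gt0.
move: (ln H) => y dy; have y0 : 0 < y.
  by apply: lt_le_trans dy; rewrite invr_gt0 exprn_gt0.
have dy0 : 0 <= d * y by rewrite mulr_ge0 ?ltW.
rewrite -[leRHS](ger0_norm dy0) -sqrtr_sqr ler_wsqrtr //.
have s0 : 0 < Num.sqrt y by rewrite sqrtr_gt0.
have sE : Num.sqrt y ^+ 2 = y by rewrite sqr_sqrtr ?ltW.
have ly : ln y <= 2 * Num.sqrt y.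
  have -> : ln y = 2 * ln (Num.sqrt y) by rewrite -{1}sE lnXn // mulr_natl.
  by have := ln_sublinear s0; lra.
have ds : 1 <= d ^+ 2 * Num.sqrt y.
  have : (d ^+ 2)^-1 <= Num.sqrt y.
    have i0 : 0 <= (d ^+ 2)^-1 by rewrite invr_ge0 exprn_ge0 ?ltW.
    rewrite -(ger0_norm i0) -sqrtr_sqr ler_wsqrtr // exprVn -exprM.
    exact: dy.
  by rewrite -ler_pdivrMl ?exprn_gt0 // mulr1.
have : y * ln y <= y * (2 * Num.sqrt y) by rewrite ler_wpM2l // ltW.
have : Num.sqrt y * y * 1 <= Num.sqrt y * y * (d ^+ 2 * Num.sqrt y).
  by rewrite ler_wpM2l // mulr_ge0 // ltW.
have -> : Num.sqrt y * y * (d ^+ 2 * Num.sqrt y) = (d * y) ^+ 2.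
  by transitivity (Num.sqrt y ^+ 2 * y * d ^+ 2); [ring|rewrite sE; ring].
lra.
Qed.
Variable n : nat.
Hypothesis n1 : (1 <= n)%N.

(** A saving that is at most [1 / (4 n)], the one from sparse sets, and at most
    [1 - theta = 1 / 48], the one from the squarefree count. *)
Let delta : R := (48 * n%:R)^-1.

(** The three terms cover, in order, the error in [S ^ n], the passage to the falling factorial, and
    the sets that are not sparse. *)
Let C : R := 12 * n%:R + n%:R ^+ 2 + 4 * n%:R ^+ 2 * n`!%:R.

Lemma G_estimate (H : R) : 16 `^ (4 * n%:R) <= H ->
  `| n`!%:R * (G n H)%:R - (zeta (2 : R))^-1 ^+ n * H ^+ n |
     <= C * H `^ (- delta) * H ^+ n.
Proof.
have expo : (5 * n + (2 * n).-1 <= (4 * n).-1 * 2)%N by move: n1; lia.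
have npred : (1 < n)%N -> (n = 2 + n.-2)%N by lia.
move=> H16.
have nr0 : (0 : R) < n%:R by rewrite ltr0n.
have nr1 : (1 : R) <= n%:R by rewrite ler1n.
have n40 : (0 : R) < 4 * n%:R by rewrite mulr_gt0.
have H1 : 1 <= H.
  by apply: le_trans H16; rewrite -[leLHS](powRr0 16); apply: ler_powR; lra.
have H0 : 0 < H by lra.
pose q := H `^ (4 * n%:R)^-1.
have qH : q ^+ (4 * n) = H.
  by rewrite -powR_mulrn ?powR_ge0 // /q -powRrM natrM mulVf ?gt_eqF // powRr1 // ltW.
have q16 : 16 <= q.
  have E : 16 = (16 `^ (4 * n%:R)) `^ (4 * n%:R)^-1 :> R.
    by rewrite -powRrM mulfV ?gt_eqF // powRr1.
  rewrite /q [leLHS]E.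
  by rewrite ge0_ler_powR ?nnegrE ?powR_ge0 ?(ltW H0) // invr_ge0 ltW.
have q0 : 0 <= q by lra.
(* [L] is of size [H / Q], so elements at most [L] are rare, while [L ^ 2]
   still exceeds [H * Q ^ (2 n - 1)] once [Q >= 16]. *)
pose Q := Num.truncn q; pose N := Num.truncn H; pose L := (Q ^ (4 * n).-1)%N.
have /andP[Qq qQ] := truncn_itv q0; rewrite -/Q -natr1 in Qq qQ.
have Q16 : (16 <= Q)%N by rewrite truncn_ge_nat.
have Qr16 : 16 <= Q%:R :> R by rewrite (ler_nat R 16).
have Q0 : (0 : R) < Q%:R by lra.
have /andP[NH HN] := truncn_itv (ltW H0); rewrite -/N in NH HN.
have Qpos : (0 < Q)%N by apply: leq_trans Q16.
have L0 : (0 < L)%N by rewrite expn_gt0 Qpos.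
have LQ : L%:R <= H / Q%:R.
  rewrite ler_pdivlMr // -natrM /L -expnSr prednK ?muln_gt0 //.
  by rewrite natrX -qH lerXn2r ?nnegrE // ltW.
have NQL : (N * Q ^ (2 * n).-1 < L ^ 2)%N.
  (* Here [(2 * Q) ^ (4 * n) = 16 ^ n * Q ^ (4 * n)] is at most [Q ^ (5 * n)] because [16 <= Q], and
     [5 n + (2 n - 1) <= 2 (4 n - 1)] because [n >= 1]. *)
  have NQ : (N < (2 * Q) ^ (4 * n))%N.
    have n4 : (4 * n != 0)%N by rewrite muln_eq0 -lt0n.
    rewrite -(ltr_nat R) (le_lt_trans NH) // natrX natrM -[ltLHS]qH.
    have q2 : q < 2%:R * Q%:R by lra.
    by rewrite ltrXn2r // ?nnegrE // ltW.
  have le1 : ((2 * Q) ^ (4 * n) <= Q ^ (5 * n))%N.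
    rewrite expnMn !expnM -[(2 ^ 4)%N]/16%N -expnMn leq_exp2r //.
    by rewrite (expnS Q 4) leq_mul2r Q16 orbT.
  have le2 : (Q ^ (5 * n) * Q ^ (2 * n).-1 <= L ^ 2)%N.
    by rewrite /L -expnM -expnD leq_pexp2l.
  apply: leq_trans le2; rewrite ltn_mul2r expn_gt0 Qpos /=.
  exact: leq_trans NQ le1.
have powHD r s : H `^ (r + s) = H `^ r * H `^ s.
  by rewrite powRD // (gt_eqF H0) implybT.
set eta := H `^ (- delta); set S := squarefree_count N.
have eta0 : 0 <= eta by apply: powR_ge0.
have d0 : 0 <= delta by rewrite invr_ge0 mulr_ge0.
have Heta : 1 <= eta * H.
  rewrite /eta -[X in _ * X](powRr1 (ltW H0)) -powHD.
  rewrite -[leLHS](powRr0 H) ler_powR // addrC subr_ge0 /delta invf_le1 ?mulr_gt0 //.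
  lra.
(* Indeed [eta^-1 = H ^ delta <= q], and [q <= Q + 1 <= 2 * Q]. *)
have Qeta : Q%:R^-1 <= 2 * eta.
  have -> : 2 * eta = (2^-1 * eta^-1)^-1 by rewrite invfM !invrK.
  have e0 : 0 < eta by rewrite powR_gt0.
  rewrite lef_pV2 ?posrE ?mulr_gt0 ?invr_gt0 //.
  have : eta^-1 <= q.
    rewrite /eta powRN invrK ler_powR // /delta lef_pV2 ?posrE ?mulr_gt0 //.
    by lra.
  lra.
have SN : S%:R <= H by rewrite (le_trans _ NH) // ler_nat squarefree_count_le.
set c := (zeta (2 : R))^-1.
have c0 : 0 <= c by rewrite invr_ge0 (le_trans _ (zeta2_ge1 R)).
have c1 : c <= 1 by rewrite invf_le1 ?zeta2_ge1 // (lt_le_trans _ (zeta2_ge1 R)).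
have Sest : `|S%:R - c * H| <= 12 * (eta * H).
  apply: (le_trans (squarefree_count_estimate (ltW H0))).
  rewrite ler_wpM2l // /eta -[X in _ * X](powRr1 (ltW H0)) -powHD.
  rewrite ler_powR // /theta.
  suff : delta <= 48^-1 by lra.
  by rewrite /delta lef_pV2 ?posrE ?mulr_gt0 //; lra.
have Hn0 : 0 <= H ^+ n by rewrite exprn_ge0 ?ltW.
have HnE : H ^+ n = H ^+ n.-1 * H by rewrite -exprSr prednK.
have Hn10 : 0 <= H ^+ n.-1 by rewrite exprn_ge0 ?ltW.
have Sn : `|S%:R ^+ n - c ^+ n * H ^+ n| <= 12 * n%:R * eta * H ^+ n.
  rewrite -exprMn; apply: (le_trans (@dist_expr_le _ _ H n _ _)).
  - by rewrite SN ler0n.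
  - apply/andP; split; first by rewrite mulr_ge0 // ltW.
    by rewrite -[leRHS]mul1r ler_wpM2r // ltW.
  apply: (le_trans (ler_wpM2l _ Sest)); first by rewrite mulr_ge0.
  by rewrite HnE le_eqVlt; apply/orP; left; apply/eqP; ring.
set g := (G n H)%:R : R; set f := n`!%:R : R.
have f1 : 1 <= f by rewrite ler1n fact_gt0.
have up : f * g <= S%:R ^+ n.
  rewrite -natrX -natrM ler_nat mulnC.
  apply: leq_trans (ffact_le_expn S n); rewrite -bin_ffact leq_mul2r.
  by rewrite (G_le n (ltW H0)) orbT.
have lowN : (S ^ n <= n`! * (G n H + (n * (L * N ^ n.-1) +
    n * n.-1 * \sum_(Q.+1 <= h < N.+1) (N %/ h) ^ 2 * N ^ n.-2)) +
    n ^ 2 * N ^ n.-1)%N.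
  apply: (leq_trans (expn_ffact_le S n)); apply: leq_add; last first.
    by rewrite leq_mul2l; case: n.-1 => [|k]; rewrite ?expn0 ?orbT // leq_exp2r // squarefree_count_le orbT.
  rewrite -bin_ffact mulnC leq_mul2l; apply/orP; right.
  apply: (leq_trans (binomial_squarefree_le n N L Q)); rewrite leq_add2r.
  exact: (G_ge (ltW H0) L0 NQL).
have NnH k : (N ^ k)%:R <= H ^+ k by rewrite natrX lerXn2r ?nnegrE ?(ltW H0).
have t1 : (n * (L * N ^ n.-1))%:R <= n%:R * (2 * eta * H ^+ n) :> R.
  rewrite natrM ler_wpM2l // natrM HnE.
  apply: (@le_trans _ _ (H / Q%:R * H ^+ n.-1)); first by apply: ler_pM.
  have := ler_wpM2l (mulr_ge0 Hn10 (ltW H0)) Qeta; lra.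
(* The bound is written with [n^2 - n] so that adding [t1] leaves [n^2]. The case [n = 1], where
   there are no pairs, is separate because [n.-2] then truncates. *)
have t2 : (n * n.-1 * \sum_(Q.+1 <= h < N.+1) (N %/ h) ^ 2 * N ^ n.-2)%:R
    <= n%:R ^+ 2 * (2 * eta * H ^+ n) - n%:R * (2 * eta * H ^+ n) :> R.
  have -> : n%:R ^+ 2 * (2 * eta * H ^+ n) - n%:R * (2 * eta * H ^+ n) =
    (n * n.-1)%:R * (2 * eta * H ^+ n).
    rewrite natrM -subn1 natrB //; ring.
  rewrite natrM; have [n2|n2] := leqP n 1.
    have -> : n.-1 = 0%N by apply/eqP; rewrite -leqn0 -ltnS prednK.
    by rewrite muln0 !mul0r.
  rewrite ler_wpM2l // -big_distrl /= natrM.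
  have -> : H ^+ n = H ^+ 2 * H ^+ n.-2 by rewrite -exprD -npred.
  rewrite mulrA; apply: ler_pM => //.
  apply: (le_trans (sum_divn_sq_le N Qpos)).
  rewrite [leRHS]mulrC; apply: ler_pM; rewrite ?exprn_ge0 ?invr_ge0 ?(ltW Q0) //.
  by rewrite -natrX NnH.
have t3 : (n ^ 2 * N ^ n.-1)%:R <= n%:R ^+ 2 * (eta * H ^+ n) :> R.
  rewrite natrM natrX ler_wpM2l ?exprn_ge0 // (le_trans (NnH _)) // HnE.
  by rewrite mulrCA -[leLHS]mulr1 ler_wpM2l.
have low : S%:R ^+ n <= f * (g + n%:R ^+ 2 * (2 * eta * H ^+ n)) + n%:R ^+ 2 * (eta * H ^+ n).
  move: lowN; rewrite -(ler_nat R) natrX => /le_trans; apply.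
  rewrite natrD natrM; apply: lerD => //; rewrite ler_wpM2l // !natrD lerD2l.
  by apply: (le_trans (lerD t1 t2)); rewrite addrC subrK.
move: Sn; rewrite !ler_norml => /andP[s1 s2]; rewrite /C -/f.
have p1 : 0 <= n%:R ^+ 2 * (eta * H ^+ n).
  by rewrite mulr_ge0 ?exprn_ge0 // mulr_ge0.
have p2 : 0 <= f * (n%:R ^+ 2 * (eta * H ^+ n)) by rewrite mulr_ge0 // (le_trans _ f1).
apply/andP; split; lra.
Qed.
End Estimate.

Theorem theorem3p3 (R : realType) (n : nat) (n_ge1 : (1 <= n)%N) :
  exists (E eps : R -> R) (C : R),
    [/\ eps H @[H --> +oo] --> (0 : R),
        \forall H \near +oo,
          `|E H| <= C * expR (- ((1 + eps H) * Num.sqrt (ln H * ln (ln H) / 2)))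
      & \forall H \near +oo,
          (G n H)%:R = (1 / (n`!%:R * zeta (2 : R) ^+ n) + E H) * H ^+ n].
Proof.
pose c : R := 1 / (n`!%:R * zeta (2 : R) ^+ n).
pose C : R := 12 * n%:R + n%:R ^+ 2 + 4 * n%:R ^+ 2 * n`!%:R.
(* [E] is the exact normalised remainder, so the last claim only needs [H] nonzero. *)
exists (fun H => (G n H)%:R / H ^+ n - c), (fun=> 0), C; split.
- exact: cvg_cst.
- pose d : R := (48 * n%:R)^-1.
  have d0 : 0 < d by rewrite invr_gt0 mulr_gt0 // ltr0n.
  near=> H.
  have H0 : 0 < H by near: H; apply: nbhs_pinfty_gt.
  have H16 : 16 `^ (4 * n%:R) <= H by near: H; apply: nbhs_pinfty_ge.
  have Hd : expR (d ^- 4) <= H by near: H; apply: nbhs_pinfty_ge.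
  have Hn0 : 0 < H ^+ n by rewrite exprn_gt0.
  have C0 : 0 <= C by rewrite !addr_ge0 // !mulr_ge0 // exprn_ge0.
  rewrite addr0 mul1r.
  apply: (@le_trans _ _ (C * H `^ (- d))); last first.
    by rewrite ler_wpM2l // powR_le_expR_sqrt.
  have := G_estimate n_ge1 H16; rewrite -/C -/d.
  have f0 : 0 < n`!%:R :> R by rewrite ltr0n fact_gt0.
  have z0 : zeta (2 : R) != 0 by rewrite gt_eqF // (lt_le_trans _ (zeta2_ge1 R)).
  have -> : n`!%:R * (G n H)%:R - (zeta (2 : R))^-1 ^+ n * H ^+ n =
      n`!%:R * ((G n H)%:R / H ^+ n - c) * H ^+ n.
    rewrite /c exprVn; move: (lt0r_neq0 Hn0) (lt0r_neq0 f0) (expf_neq0 n z0).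
    move: (H ^+ n) (n`!%:R) (zeta 2 ^+ n) => h f z h0 fn0 zn0; field.
    by rewrite h0 fn0 zn0.
  rewrite normrM (gtr0_norm Hn0) ler_pM2r // normrM (gtr0_norm f0).
  (* The estimate bounds the error multiplied by [n]!, which is at least 1. *)
  apply: le_trans; rewrite -[leLHS]mul1r ler_wpM2r // ler1n fact_gt0 //.
- near=> H.
  have H0 : 0 < H by near: H; apply: nbhs_pinfty_gt.
  by rewrite addrC subrK divfK // expf_neq0 // gt_eqF.
Unshelve. all: by end_near. Qed.
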